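(* $\mathit{sol}_{\mathcal{M}^{C}}(S)$ is satisfied by $\mathcal{L}(A)$ if and only if Player $\exists$ has a winning strategy in the game $\mathcal{G}$.
   Context: A higher-order game is $\mathcal{G}=(G,A,O)$ where $G=(V,N,T,R,S)$ is a word-generating (possibly non-deterministic) higher-order recursion scheme (terminals are $T\cup\{\$\}$ with $\$:o$ and every $a\in T$ of kind $o\to o$, so a generated tree $a_1(a_2(\cdots(a_k\ \$)))$ is read as the word $a_1\cdots a_k$), $A$ is an NFA over $T$, and $O:N\to\{\exists,\forall\}$ assigns each non-terminal to a player. A play starts at $S$ and repeatedly performs outermost-to-innermost rewriting of the unique redex $F\ t_1\cdots t_m$, the rule for $F$ being chosen by its owner $O(F)$. Infinite plays are won by $\exists$; a finite maximal play producing word $w$ is won by $\exists$ iff $w\in\mathcal{L}(A)$. The determinised scheme $G^{\det}$ replaces the rules $F=\lambda\vec x.e_1,\dots,F=\lambda\vec x.e_\ell$ of each $F$ by the single rule $F=\lambda\vec x.\,\mathit{op}_F\ e_1\cdots e_\ell$ with a new terminal $\mathit{op}_F:o\to\cdots\to o$ of arity $\ell$. The concrete model $\mathcal{M}^{C}=(\mathcal{D}^{C},\mathcal{I}^{C})$ has ground domain $\mathcal{D}^{C}_o$ = non-empty (possibly infinite) sets of finite positive Boolean formulas whose atomic propositions are words in $T^*$, taken modulo logical equivalence (a set is read as the conjunction of its elements; an assignment $P'\subseteq T^*$ makes a word true iff it is in $P'$, and satisfies a set iff it satisfies every element); ordered by implication, with top element $\{\mathit{true}\}$, meet = union, and disjunction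 of sets $\Phi_1\vee\Phi_2=\{\varphi_1\vee\varphi_2\mid \varphi_i\in\Phi_i\}$. Higher kinds are the $\sqcap$-continuous function spaces ordered pointwise. The interpretation is $\mathcal{I}^{C}(\$)=\{\varepsilon\}$, $\mathcal{I}^{C}(a)$ prepends $a$ to every word occurring in the formulas (distributing over $\wedge,\vee$, fixing $\mathit{true}$), and $\mathcal{I}^{C}(\mathit{op}_F)$ is $\ell$-ary conjunction if $O(F)=\forall$ and $\ell$-ary disjunction if $O(F)=\exists$. The semantics $\mathit{sol}_{\mathcal{M}^{C}}$ is the greatest solution of $\nu=\mathit{rhs}(\nu)$ where $\mathit{rhs}(\nu)(F)=[\![t_F]\!]\,\nu$ for the rule $F=t_F$ of $G^{\det}$, i.e. $\mathit{sol}_{\mathcal{M}^{C}}=\inf_{i\in\mathbb{N}}\mathit{rhs}^i(\top)$ (Kleene iteration from the valuation mapping every non-terminal to the top element of its domain; $\inf$ is the meet). *)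

(* Defs.v *)
From HB Require Import structures.
From mathcomp Require Import all_boot generic_quotient.
From mathcomp Require Import boolp classical_sets.

Set Implicit Arguments.
Unset Strict Implicit.
Unset Printing Implicit Defensive.

Local Open Scope classical_set_scope.
Local Open Scope quotient_scope.

Section Chains.
Variables (T : Type) (le : T -> T -> Prop).

Definition descending (c : nat -> T) := forall i, le (c i.+1) (c i).

Definition is_inf (c : nat -> T) (x : T) :=
  (forall i, le x (c i)) /\ (forall y, (forall i, le y (c i)) -> le y x).

End Chains.

Record cppo := Cppo {
  carrier :> Type;
  cle : carrier -> carrier -> Prop;
  ctop : carrier;
  cle_refl : forall x, cle x x;
  cle_trans : forall x y z, cle x y -> cle y z -> cle x z;
  cle_anti : forall x y, cle x y -> cle y x -> x = y;
  cle_top : forall x, cle x ctop;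
  inf_exists : forall c, descending cle c -> exists x, is_inf cle c x
}.

Arguments cle {_} _ _.
Arguments ctop {_}.

(* The infimum of c; it is ctop (a junk value) if c has no infimum. *)
Definition inf (D : cppo) (c : nat -> D) : D :=
  xget (ctop : {classic D}) [set x | is_inf cle c x].

Definition meet_continuous (D E : cppo) (f : D -> E) :=
  forall c x, descending cle c -> is_inf cle c x ->
    is_inf cle (fun i => f (c i)) (f x).

Section CppoTheory.
Variables D E : cppo.

Lemma infP (c : nat -> D) : descending cle c -> is_inf cle c (inf c).
Proof. by move=> dc; exact: (xgetPex (ctop : {classic D}) (inf_exists dc)). Qed.

Lemma is_inf_uniq (c : nat -> D) x y : is_inf cle c x -> is_inf cle c y -> x = y.
Proof. by move=> [xl xg] [yl yg]; apply: cle_anti; [exact: yg|exact: xg]. Qed.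

Lemma descending_le (c : nat -> D) i j :
  descending cle c -> (i <= j)%N -> cle (c j) (c i).
Proof.
move=> dc /subnK <-; elim: (j - i)%N => [|k IH]; first exact: cle_refl.
by rewrite addSn; apply: cle_trans IH; exact: dc.
Qed.

Lemma meet_continuous_mono (f : D -> E) x y :
  meet_continuous f -> cle x y -> cle (f x) (f y).
Proof.
move=> fc lexy.
have [] := fc (fun i => if i is 0 then y else x) x.
- by case=> [|i] //=; exact: cle_refl.
- split=> [[|i]//|z]; [exact: cle_refl | by move/(_ 1%N)].
by move=> /(_ 0%N).
Qed.

Lemma meet_continuous_descending (f : D -> E) c :
  meet_continuous f -> descending cle c -> descending cle (fun i => f (c i)).
Proof. by move=> fc dc i; exact: meet_continuous_mono. Qed.

End CppoTheory.

Record cont (D E : cppo) := Cont {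
  cont_fun :> D -> E;
  cont_funP : meet_continuous cont_fun
}.

Section FunctionSpace.
Variables D E : cppo.

Definition cont_le (f g : cont D E) := forall x, cle (f x) (g x).

Lemma cst_continuous (e : E) : meet_continuous (fun _ : D => e).
Proof.
by move=> c x _ _; split=> [_|y /(_ 0%N)//]; exact: cle_refl.
Qed.

Definition cst_cont (e : E) : cont D E := Cont (cst_continuous e).

Lemma cont_eq (f g : cont D E) : (forall x, f x = g x) -> f = g.
Proof.
case: f g => [f fP] [g gP] /= /funext fg; move: fP gP; rewrite fg => fP gP.
by congr Cont; exact: Prop_irrelevance.
Qed.

Lemma pointwise_inf_continuous (c : nat -> cont D E) :
  descending cont_le c -> meet_continuous (fun x => inf (fun i => c i x)).
Proof.
move=> dc u x du [xl xg].
have ip z : is_inf cle (fun i => c i z) (inf (fun i => c i z)).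
  by apply: infP => i; exact: dc.
split=> [j|y yl].
  apply: (ip (u j)).2 => i; apply: cle_trans ((ip x).1 i) _.
  exact: meet_continuous_mono (cont_funP (c i)) (xl j).
apply: (ip x).2 => i; apply: ((cont_funP (c i)) u x du (conj xl xg)).2 => j.
exact: cle_trans (yl j) ((ip (u j)).1 i).
Qed.

Lemma cont_inf_exists (c : nat -> cont D E) :
  descending cont_le c -> exists f, is_inf cont_le c f.
Proof.
move=> dc; exists (Cont (pointwise_inf_continuous dc)).
have ip z : is_inf cle (fun i => c i z) (inf (fun i => c i z)).
  by apply: infP => i; exact: dc.
split=> [i x|g gl x] /=; first exact: (ip x).1.
by apply: (ip x).2 => i; exact: gl.
Qed.

Definition cont_cppo : cppo.
Proof.
apply: (@Cppo (cont D E) cont_le (cst_cont ctop) _ _ _ _ cont_inf_exists).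
- by move=> f x; exact: cle_refl.
- by move=> f g h fg gh x; exact: cle_trans (fg x) (gh x).
- by move=> f g fg gf; apply: cont_eq => x; exact: cle_anti.
- by move=> f x; exact: cle_top.
Defined.

Lemma cont_is_inf (c : nat -> cont_cppo) (f : cont_cppo) :
  descending cle c ->
  is_inf cle c f <-> forall x, is_inf cle (fun i => c i x) (f x).
Proof.
move=> dc; split=> [fi x|fi].
  have ip : is_inf cle c (Cont (pointwise_inf_continuous dc) : cont_cppo).
    have iq z : is_inf cle (fun i => c i z) (inf (fun i => c i z)).
      by apply: infP => i; exact: dc.
    split=> [i z|g gl z] /=; first exact: (iq z).1.
    by apply: (iq z).2 => i; exact: gl.
  by rewrite (is_inf_uniq fi ip); apply: infP => i; exact: dc.
by split=> [i x|g gl x]; [exact: (fi x).1|apply: (fi x).2 => i; exact: gl].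
Qed.

End FunctionSpace.

Section Product.
Variables (I : Type) (D : I -> cppo).

Definition prod_le (f g : forall i, D i) := forall i, cle (f i) (g i).

Lemma prod_is_infW (c : nat -> forall i, D i) (f : forall i, D i) :
  (forall i, is_inf cle (fun n => c n i) (f i)) -> is_inf prod_le c f.
Proof.
by move=> fi; split=> [n i|g gl i];
  [exact: (fi i).1|apply: (fi i).2 => n; exact: gl].
Qed.

Lemma prod_inf_exists (c : nat -> forall i, D i) :
  descending prod_le c -> exists f, is_inf prod_le c f.
Proof.
move=> dc; exists (fun i => inf (fun n => c n i)); apply: prod_is_infW => i.
by apply: infP => n; exact: dc.
Qed.

Definition prod_cppo : cppo.
Proof.
apply: (@Cppo (forall i, D i) prod_le (fun=> ctop) _ _ _ _ prod_inf_exists).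
- by move=> f i; exact: cle_refl.
- by move=> f g h fg gh i; exact: cle_trans (fg i) (gh i).
- by move=> f g fg gf; apply: functional_extensionality_dep => i; exact: cle_anti.
- by move=> f i; exact: cle_top.
Defined.

Lemma prod_is_inf (c : nat -> prod_cppo) (f : prod_cppo) :
  descending cle c ->
  is_inf cle c f <-> forall i, is_inf cle (fun n => c n i) (f i).
Proof.
move=> dc; split=> [fi i|]; last exact: prod_is_infW.
have iq j : is_inf cle (fun n => c n j) (inf (fun n => c n j)).
  by apply: infP => n; exact: dc.
have ip : is_inf cle c ((fun j => inf (fun n => c n j)) : prod_cppo).
  exact: prod_is_infW.
by rewrite (is_inf_uniq fi ip).
Qed.

End Product.

Section Application.
Variables D E F : cppo.

Lemma app_continuous (f : cont D (cont_cppo E F)) (g : cont D E) :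
  meet_continuous (fun x => (f x : cont E F) (g x)).
Proof.
move=> c x dc xi.
have df : descending cle (fun i => f (c i)).
  exact: meet_continuous_descending (cont_funP f) dc.
have dg : descending cle (fun i => g (c i)).
  exact: meet_continuous_descending (cont_funP g) dc.
have fi := (cont_is_inf _ df).1 (cont_funP f dc xi).
have gi := cont_funP g dc xi.
split=> [i|y yl].
  apply: cle_trans ((fi (g x)).1 i) _.
  exact: meet_continuous_mono (cont_funP (f (c i) : cont E F)) (gi.1 i).
apply: (fi (g x)).2 => i.
apply: (cont_funP (f (c i) : cont E F) dg gi).2 => j.
apply: cle_trans (yl (maxn i j)) _.
apply: cle_trans (_ : cle ((f (c i) : cont E F) (g (c (maxn i j)))) _).
  exact: (descending_le df (leq_maxl i j)).
apply: meet_continuous_mono; first exact: cont_funP.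
exact: (descending_le dg (leq_maxr i j)).
Qed.

Lemma comp_continuous (g : cont E F) (f : cont D E) :
  meet_continuous (fun x => g (f x)).
Proof.
move=> c x dc xi; apply: (cont_funP g); last exact: cont_funP.
exact: meet_continuous_descending (cont_funP f) dc.
Qed.

Definition comp_cont (g : cont E F) (f : cont D E) : cont D F :=
  Cont (comp_continuous g f).

Lemma postcomp_continuous (g : cont E F) :
  @meet_continuous (cont_cppo D E) (cont_cppo D F) (comp_cont g).
Proof.
move=> c f dc fi; have fi' := (cont_is_inf _ dc).1 fi.
apply/cont_is_inf => [i x|x] /=.
  by apply: meet_continuous_mono (cont_funP g) _; exact: dc.
by apply: (cont_funP g) => // i; exact: dc.
Qed.

Definition postcomp (g : cont E F) : cont (cont_cppo D E) (cont_cppo D F) :=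
  Cont (postcomp_continuous g).

End Application.

Section Update.
Variables (I : eqType) (D : I -> cppo) (E : cppo) (i : I).
Local Notation P := (prod_cppo D).

Lemma update_val_continuous (f : P) :
  @meet_continuous (D i) P (fun v => dfwith f v).
Proof.
move=> c v dc vi; apply/prod_is_inf => [n j|j].
  rewrite /dfwith; case: eqP => [ij|_]; last exact: cle_refl.
  by case: _ / ij; exact: dc.
rewrite /dfwith; case: eqP => [ij|_]; first by case: _ / ij.
exact: (@cst_continuous (D i)) dc vi.
Qed.

Lemma update_env_continuous (v : D i) :
  @meet_continuous P P (fun f => dfwith f v).
Proof.
move=> c f dc fi; have fi' := (prod_is_inf _ dc).1 fi.
apply/prod_is_inf => [n j|j].
  by rewrite /dfwith; case: eqP => [ij|_]; [exact: cle_refl|exact: dc].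
rewrite /dfwith; case: eqP => [ij|_]; last exact: fi'.
by case: _ / ij; apply: (cst_continuous v) dc fi.
Qed.

Lemma abstract_in_continuous (g : cont P E) (f : P) :
  meet_continuous (fun v : D i => g (dfwith f v)).
Proof. exact: (comp_continuous g (Cont (update_val_continuous f))). Qed.

Lemma abstract_continuous (g : cont P E) :
  @meet_continuous P (cont_cppo (D i) E)
    (fun f => Cont (abstract_in_continuous g f)).
Proof.
move=> c f dc fi; apply/cont_is_inf => [n v|v] /=.
  exact: (meet_continuous_descending
    (comp_continuous g (Cont (update_env_continuous v))) dc n).
exact: (comp_continuous g (Cont (update_env_continuous v))) dc fi.
Qed.

(* f |-> (v |-> g (f[i := v])) *)
Definition abstract (g : cont P E) : cont P (cont_cppo (D i) E) :=
  Cont (abstract_continuous g).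

End Update.

Inductive kind := ground | arrow (k1 k2 : kind).

Fixpoint nary (n : nat) : kind :=
  if n is n'.+1 then arrow ground (nary n') else ground.

Record ksyms := KSyms { sym :> finType; knd : sym -> kind }.

Definition ksum (X Y : ksyms) : ksyms :=
  @KSyms (X + Y)%type
    (fun s => match s with inl x => knd x | inr y => knd y end).

Section Terms.
Variables V N T : ksyms.

(* Only lambda-free terms: the abstractions of a rule are kept apart, in rhs. *)
Inductive term : kind -> Type :=
| TVar (x : V) : term (knd x)
| TNon (F : N) : term (knd F)
| TTer (a : T) : term (knd a)
| TApp (k1 k2 : kind) : term (arrow k1 k2) -> term k1 -> term k2.

Fixpoint free_vars k (t : term k) : seq V :=
  match t with
  | TVar x => [:: x]
  | TNon _ => [::]
  | TTer _ => [::]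
  | TApp _ _ t1 t2 => free_vars t1 ++ free_vars t2
  end.

Fixpoint subst (s : forall x : V, term (knd x)) k (t : term k) : term k :=
  match t with
  | TVar x => s x
  | TNon F => TNon F
  | TTer a => TTer a
  | TApp _ _ t1 t2 => TApp (subst s t1) (subst s t2)
  end.

(* The sequences lambda x1 ... lambda xm such that lambda x1 ... lambda xm. e
   has kind k when e has ground kind. *)
Inductive binders : kind -> Type :=
| BNil : binders ground
| BCons (x : V) (k : kind) : binders k -> binders (arrow (knd x) k).

Fixpoint bound_vars k (b : binders k) : seq V :=
  if b is BCons x _ b' then x :: bound_vars b' else [::].

(* Rhs b e is lambda b. e *)
Record rhs (k : kind) := Rhs { rhs_binders : binders k; rhs_body : term ground }.

Fixpoint args (k : kind) : Type :=
  if k is arrow k1 k2 then (term k1 * args k2)%type else unit.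

(* t t1 ... tm *)
Fixpoint apps (k : kind) : term k -> args k -> term ground :=
  match k with
  | ground => fun t _ => t
  | arrow k1 k2 => fun t ts => apps (TApp t ts.1) ts.2
  end.

(* e[x1 := t1, ..., xm := tm], starting from the substitution s *)
Fixpoint instantiate k (b : binders k) (e : term ground)
    (s : forall x : V, term (knd x)) : args k -> term ground :=
  match b in binders k return args k -> term ground with
  | BNil => fun _ => subst s e
  | BCons x _ b' => fun ts => instantiate b' e (dfwith s ts.1) ts.2
  end.

Definition contract k (r : rhs k) (ts : args k) : term ground :=
  instantiate (rhs_binders r) (rhs_body r) TVar ts.

(* f e1 ... en *)
Fixpoint nary_app (es : seq (term ground)) : term (nary (size es)) -> term ground :=
  match es return term (nary (size es)) -> term ground with
  | [::] => fun f => f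
  | e :: es' => fun f => nary_app (TApp f e)
  end.

End Terms.

Arguments TVar {V N T} x.
Arguments TNon {V N T} F.
Arguments TTer {V N T} a.

(* The rules of F are  F = lambda (params F). e  for e in the non-empty finite
   list bodies F. *)
Record scheme (T : ksyms) := Scheme {
  vars : ksyms;
  nonterms : ksyms;
  params : forall F : nonterms, binders vars (knd F);
  bodies : forall F : nonterms, seq (term vars nonterms T ground);
  bodies_neq0 : forall F, (0 < size (bodies F))%N;
  bodies_closed : forall F (i : 'I_(size (bodies F))),
    {subset free_vars (tnth (in_tuple (bodies F)) i) <= bound_vars (params F)};
  start : nonterms;
  start_ground : knd start = ground
}.

Arguments start {T} s.

Definition nrules T (G : scheme T) (F : nonterms G) : nat := size (bodies F).

Definition rule T (G : scheme T) (F : nonterms G) (i : 'I_(nrules F)) :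
    rhs (vars G) (nonterms G) T (knd F) :=
  Rhs (params F) (tnth (in_tuple (bodies F)) i).

Definition start_term T (G : scheme T) : term (vars G) (nonterms G) T ground :=
  ecast k (term _ _ _ k) (start_ground G) (TNon (start G)).

Record det_scheme (T : ksyms) := DetScheme {
  dvars : ksyms;
  dnonterms : ksyms;
  drule : forall F : dnonterms, rhs dvars dnonterms T (knd F);
  dstart : dnonterms;
  dstart_ground : knd dstart = ground
}.

Definition op_syms T (G : scheme T) : ksyms :=
  @KSyms (nonterms G) (fun F => nary (nrules F)).

Definition det_terminals T (G : scheme T) : ksyms := ksum T (op_syms G).

Fixpoint embed V N T T' k (t : term V N T k) : term V N (ksum T T') k :=
  match t with
  | TVar x => TVar x
  | TNon F => TNon F
  | TTer a => @TTer V N (ksum T T') (inl a)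
  | TApp _ _ t1 t2 => TApp (embed T' t1) (embed T' t2)
  end.

Definition op_term T (G : scheme T) (F : nonterms G) :
    term (vars G) (nonterms G) (det_terminals G)
      (nary (size [seq embed (op_syms G) e | e <- bodies F])) :=
  ecast n (term _ _ _ (nary n)) (esym (size_map _ (bodies F)))
    (@TTer (vars G) (nonterms G) (det_terminals G) (inr F)).

Definition determinize T (G : scheme T) : det_scheme (det_terminals G) :=
  {| dvars := vars G;
     dnonterms := nonterms G;
     drule := fun F => Rhs (params F) (nary_app (op_term F));
     dstart := start G;
     dstart_ground := start_ground G |}.

Fixpoint dom (D : cppo) (k : kind) : cppo :=
  if k is arrow k1 k2 then cont_cppo (dom D k1) (dom D k2) else D.

Record model (T : ksyms) := Model {
  ground_dom : cppo;
  interp : forall a : T, dom ground_dom (knd a)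
}.

Definition valuation (X : ksyms) (D : cppo) : cppo :=
  prod_cppo (fun x : X => dom D (knd x)).

Section Semantics.
Variables (V N T : ksyms) (M : model T).
Local Notation D := (dom (ground_dom M)).
Local Notation val := (valuation (ksum V N) (ground_dom M)).

Fixpoint eval (v : val) k (t : term V N T k) : D k :=
  match t in term _ _ _ k return D k with
  | TVar x => v (inl x)
  | TNon F => v (inr F)
  | TTer a => interp M a
  | TApp k1 k2 t1 t2 => (eval v t1 : cont (D k1) (D k2)) (eval v t2)
  end.

Lemma eval_continuous k (t : term V N T k) :
  meet_continuous (fun v => eval v t).
Proof.
elim: k / t => [x|F|a|k1 k2 t1 IH1 t2 IH2] /=.
- by move=> c v dc /(prod_is_inf _ dc) /(_ (inl x)).
- by move=> c v dc /(prod_is_inf _ dc) /(_ (inr F)).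
- exact: cst_continuous.
- exact: (app_continuous (Cont IH1 : cont val (cont_cppo _ _)) (Cont IH2)).
Qed.

(* [[lambda x. r]] v is the function d |-> [[r]] (v[x := d]) *)
Fixpoint eval_binders k (b : binders V k) (f : cont val (D ground)) :
    cont val (D k) :=
  match b in binders _ k return cont val (D k) with
  | BNil => f
  | BCons x k b' =>
      @abstract (ksum V N) (fun s => D (knd s)) (D k) (inl x) (eval_binders b' f)
  end.

Definition eval_rhs k (r : rhs V N T k) : cont val (D k) :=
  eval_binders (rhs_binders r) (Cont (eval_continuous (rhs_body r))).

End Semantics.

Section Solution.
Variables (T : ksyms) (G : det_scheme T) (M : model T).
Local Notation D := (ground_dom M).
Local Notation val := (valuation (dnonterms G) D).

(* The values of the variables are irrelevant for the closed terms drule F. *)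
Definition extend (v : val) : valuation (ksum (dvars G) (dnonterms G)) D :=
  fun s => match s with inl x => ctop | inr F => v F end.

Definition rhs_fun (v : val) : val := fun F => eval_rhs M (drule F) (extend v).

Definition sol : val := inf (fun i => iter i rhs_fun ctop).

Definition sol_start : D :=
  ecast k (dom D k) (dstart_ground G) (sol (dstart G)).

Lemma rhs_fun_continuous : meet_continuous rhs_fun.
Proof.
move=> c v dc vi.
have ci := (prod_is_inf v dc).1 vi.
have de : descending cle (fun n => extend (c n)).
  by move=> n [x|F]; [exact: cle_refl|exact: dc].
have ei : is_inf cle (fun n => extend (c n)) (extend v).
  by apply/prod_is_inf => // -[x|F]; [apply: cst_continuous dc vi|exact: ci].
apply/prod_is_inf => [n F|F].
  exact: meet_continuous_descending (cont_funP (eval_rhs M (drule F))) de n.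
exact: cont_funP (eval_rhs M (drule F)) _ _ de ei.
Qed.

Lemma sol_greatest :
  sol = rhs_fun sol /\ (forall v : val, v = rhs_fun v -> cle v sol).
Proof.
pose K i := iter i rhs_fun ctop.
have mono := meet_continuous_mono rhs_fun_continuous.
have dK : descending cle K.
  by elim=> [|i IH]; [exact: cle_top|exact: mono].
have [sl sg] : is_inf cle K sol by exact: infP.
split.
  have [rl rg] := rhs_fun_continuous dK (conj sl sg).
  apply: cle_anti; first by apply: rg => i; exact: sl i.+1.
  by apply: sg => -[|i]; [exact: cle_top|exact: rl].
move=> v vE; apply: sg; elim=> [|i IH]; first exact: cle_top.
by rewrite vE; exact: mono.
Qed.

End Solution.

Section Formulas.
Variable Sigma : finType.

Inductive pform :=
| PTrue
| PWord of seq Sigma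
| PAnd of pform & pform
| POr of pform & pform.

Fixpoint psat (P : set (seq Sigma)) (f : pform) : Prop :=
  match f with
  | PTrue => True
  | PWord w => P w
  | PAnd f g => psat P f /\ psat P g
  | POr f g => psat P f \/ psat P g
  end.

Fixpoint pprepend (a : Sigma) (f : pform) : pform :=
  match f with
  | PTrue => PTrue
  | PWord w => PWord (a :: w)
  | PAnd f g => PAnd (pprepend a f) (pprepend a g)
  | POr f g => POr (pprepend a f) (pprepend a g)
  end.

Record pforms := PForms { pset :> set pform; pset_neq0 : pset !=set0 }.

HB.instance Definition _ := gen_eqMixin pforms.
HB.instance Definition _ := gen_choiceMixin pforms.

Definition ssat (P : set (seq Sigma)) (Phi : pforms) : Prop :=
  forall f, pset Phi f -> psat P f.

Definition equivalent (Phi Psi : pforms) : bool :=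
  `[< forall P, ssat P Phi <-> ssat P Psi >].

Lemma equivalent_refl : reflexive equivalent.
Proof. by move=> x; apply/asboolP. Qed.

Lemma equivalent_sym : symmetric equivalent.
Proof. by move=> x y; apply/asboolP/asboolP => xy P; rewrite xy. Qed.

Lemma equivalent_trans : transitive equivalent.
Proof.
by move=> y x z /asboolP xy /asboolP yz; apply/asboolP => P; rewrite xy.
Qed.

Canonical equivalent_equiv :=
  EquivRel equivalent equivalent_refl equivalent_sym equivalent_trans.

Definition pclass := {eq_quot equivalent}.

Definition satisfied_by (x : pclass) (P : set (seq Sigma)) : Prop :=
  ssat P (repr x).

Definition implies (x y : pclass) : Prop :=
  forall P, satisfied_by x P -> satisfied_by y P.

Lemma satisfied_by_pi (Phi : pforms) P :
  satisfied_by (\pi_pclass Phi) P <-> ssat P Phi.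
Proof.
rewrite /satisfied_by; case: piP => Psi /eqmodP /asboolP E.
exact: iff_sym (E P).
Qed.

Lemma implies_anti x y : implies x y -> implies y x -> x = y.
Proof.
move=> xy yx; rewrite -[x]reprK -[y]reprK; apply/eqmodP/asboolP => P.
by split; [exact: xy|exact: yx].
Qed.

Lemma true_neq0 : [set PTrue] !=set0.
Proof. by exists PTrue. Qed.

Definition true_class : pclass := \pi_pclass (PForms true_neq0).

Lemma word_neq0 w : [set PWord w] !=set0.
Proof. by exists (PWord w). Qed.

Definition word_class w : pclass := \pi_pclass (PForms (word_neq0 w)).

Lemma union_neq0 (c : nat -> pforms) : \bigcup_i pset (c i) !=set0.
Proof. by have [f cf] := pset_neq0 (c 0%N); exists f; exists 0%N. Qed.

Definition union_class (c : nat -> pclass) : pclass :=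
  \pi_pclass (PForms (union_neq0 (fun i => repr (c i)))).

Lemma satisfied_by_union c P :
  satisfied_by (union_class c) P <-> forall i, satisfied_by (c i) P.
Proof.
rewrite satisfied_by_pi; split=> [sat i f cf|sat f [i _ cf]].
  by apply: sat; exists i.
exact: sat cf.
Qed.

Lemma union_class_inf c : is_inf implies c (union_class c).
Proof.
split=> [i P|y yl P yP]; first by rewrite satisfied_by_union => /(_ i).
by rewrite satisfied_by_union => i; exact: yl.
Qed.

Lemma pclass_inf_exists c : descending implies c -> exists x, is_inf implies c x.
Proof. by move=> _; exists (union_class c); exact: union_class_inf. Qed.

Definition pclass_cppo : cppo.
Proof.
apply: (@Cppo pclass implies true_class _ _ implies_anti _ pclass_inf_exists).
- by move=> x P.
- by move=> x y z xy yz P /xy /yz.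
- by move=> x P _; rewrite satisfied_by_pi => f ->.
Defined.

Lemma is_inf_satisfied_by (c : nat -> pclass_cppo) (x : pclass_cppo) :
  is_inf cle c x <->
  (forall P, satisfied_by x P <-> forall i, satisfied_by (c i) P).
Proof.
split=> [xi P|xE].
  by rewrite (is_inf_uniq xi (union_class_inf c)) satisfied_by_union.
split=> [i P /xE/(_ i)//|y yl P yP]; apply/xE => i; exact: yl.
Qed.

Lemma prepend_neq0 a (Phi : pforms) : pprepend a @` pset Phi !=set0.
Proof. by have [f ff] := pset_neq0 Phi; exists (pprepend a f); exists f. Qed.

Definition prepend_class (a : Sigma) (x : pclass) : pclass :=
  \pi_pclass (PForms (prepend_neq0 a (repr x))).

Lemma psat_prepend a f P : psat P (pprepend a f) <-> psat (P \o cons a) f.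
Proof. by elim: f => //= f IHf g IHg; rewrite IHf IHg. Qed.

Lemma satisfied_by_prepend a x P :
  satisfied_by (prepend_class a x) P <-> satisfied_by x (P \o cons a).
Proof.
rewrite satisfied_by_pi; split=> [sat f xf|sat _ [f xf <-]].
  by apply/psat_prepend; apply: sat; exists f.
by apply/psat_prepend; exact: sat.
Qed.

Lemma and_neq0 (Phi Psi : pforms) : pset Phi `|` pset Psi !=set0.
Proof. by have [f ff] := pset_neq0 Phi; exists f; left. Qed.

Definition and_class (x y : pclass) : pclass :=
  \pi_pclass (PForms (and_neq0 (repr x) (repr y))).

Lemma satisfied_by_and x y P :
  satisfied_by (and_class x y) P <-> satisfied_by x P /\ satisfied_by y P.
Proof.
rewrite satisfied_by_pi; split=> [sat|[satx saty] f [xf|yf]].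
- by split=> f ff; apply: sat; [left|right].
- exact: satx.
- exact: saty.
Qed.

Lemma or_neq0 (Phi Psi : pforms) :
  [set POr f g | f in pset Phi & g in pset Psi] !=set0.
Proof.
have [f ff] := pset_neq0 Phi; have [g gg] := pset_neq0 Psi.
by exists (POr f g); exists f => //; exists g.
Qed.

Definition or_class (x y : pclass) : pclass :=
  \pi_pclass (PForms (or_neq0 (repr x) (repr y))).

Lemma satisfied_by_or x y P :
  satisfied_by (or_class x y) P <-> satisfied_by x P \/ satisfied_by y P.
Proof.
rewrite satisfied_by_pi; split=> [sat|sat _ [f xf [g yg <-]]]; last first.
  by case: sat => sat; [left|right]; exact: sat.
have [|nx] := pselect (satisfied_by x P); first by left.
right=> g yg; apply: contrapT => ng; apply: nx => f xf.
by have [] : psat P (POr f g) by apply: sat; exists f => //; exists g.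
Qed.

Lemma prepend_continuous a :
  @meet_continuous pclass_cppo pclass_cppo (prepend_class a).
Proof.
move=> c x _ /is_inf_satisfied_by xi; apply/is_inf_satisfied_by => P.
rewrite satisfied_by_prepend xi.
by split=> sat i; move: (sat i); rewrite satisfied_by_prepend.
Qed.

Definition prepend_cont a : cont pclass_cppo pclass_cppo :=
  Cont (prepend_continuous a).

Lemma and_continuous2 x : @meet_continuous pclass_cppo pclass_cppo (and_class x).
Proof.
move=> c y _ /is_inf_satisfied_by yi; apply/is_inf_satisfied_by => P.
rewrite satisfied_by_and yi; split=> [[satx sat] i|sat].
  by rewrite satisfied_by_and.
split=> [|i]; first by have /satisfied_by_and[] := sat 0%N.
by have /satisfied_by_and[] := sat i.
Qed.

Lemma and_continuous : @meet_continuous pclass_cppo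
  (cont_cppo pclass_cppo pclass_cppo) (fun x => Cont (and_continuous2 x)).
Proof.
move=> c x dc /is_inf_satisfied_by xi; apply/cont_is_inf => [i y P|y] /=.
  by rewrite !satisfied_by_and => -[/dc].
apply/is_inf_satisfied_by => P.
rewrite satisfied_by_and xi; split=> [[sat saty] i|sat].
  by rewrite satisfied_by_and.
split=> [i|]; last by have /satisfied_by_and[] := sat 0%N.
by have /satisfied_by_and[] := sat i.
Qed.

Definition and_cont : cont pclass_cppo (cont_cppo pclass_cppo pclass_cppo) :=
  Cont and_continuous.

Lemma or_continuous2 x : @meet_continuous pclass_cppo pclass_cppo (or_class x).
Proof.
move=> c y _ /is_inf_satisfied_by yi; apply/is_inf_satisfied_by => P.
rewrite satisfied_by_or yi; split=> [[satx|sat] i|sat].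
- by rewrite satisfied_by_or; left.
- by rewrite satisfied_by_or; right.
have [|nx] := pselect (satisfied_by x P); first by left.
by right=> i; have /satisfied_by_or[] := sat i.
Qed.

Lemma or_continuous : @meet_continuous pclass_cppo
  (cont_cppo pclass_cppo pclass_cppo) (fun x => Cont (or_continuous2 x)).
Proof.
move=> c x dc /is_inf_satisfied_by xi; apply/cont_is_inf => [i y P|y] /=.
  by rewrite !satisfied_by_or => -[/dc|]; [left|right].
apply/is_inf_satisfied_by => P.
rewrite satisfied_by_or xi; split=> [[sat|saty] i|sat].
- by rewrite satisfied_by_or; left.
- by rewrite satisfied_by_or; right.
have [|ny] := pselect (satisfied_by y P); first by right.
by left=> i; have /satisfied_by_or[] := sat i.
Qed.

Definition or_cont : cont pclass_cppo (cont_cppo pclass_cppo pclass_cppo) :=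
  Cont or_continuous.

End Formulas.

Section Nary.
Variables (D : cppo) (op : cont D (cont_cppo D D)).

(* x |-> y1 |-> ... |-> yn |-> op (... (op x y1) ...) yn *)
Fixpoint nary_fold (n : nat) : cont D (dom D (nary n)) :=
  match n return cont D (dom D (nary n)) with
  | 0 => @Cont D D (fun x => x) (fun c x _ xi => xi)
  | n'.+1 => comp_cont (postcomp D (nary_fold n')) op
  end.

(* The value at n = 0 is junk: every non-terminal has at least one rule. *)
Definition nary_op (n : nat) : dom D (nary n) :=
  match n return dom D (nary n) with
  | 0 => ctop
  | n'.+1 => nary_fold n'
  end.

End Nary.

Section WordTerminals.
Variable Sigma : finType.

(* None is the end marker $. *)
Definition word_terminals : ksyms :=
  @KSyms (option Sigma) (fun a => if a is Some _ then arrow ground ground else ground).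

Definition letter V N (a : Sigma) (t : term V N word_terminals ground) :
    term V N word_terminals ground :=
  TApp (@TTer V N word_terminals (Some a) : term _ _ _ (arrow ground ground)) t.

(* a1 (a2 (... (ak $))) *)
Definition word_term V N (w : seq Sigma) : term V N word_terminals ground :=
  foldr (@letter V N) (@TTer V N word_terminals None) w.

End WordTerminals.

Record nfa (Sigma : finType) := Nfa {
  state : finType;
  initial : {set state};
  final : {set state};
  trans : state -> Sigma -> state -> bool
}.

Section Language.
Variables (Sigma : finType) (A : nfa Sigma).

Fixpoint accepts_from (q : state A) (w : seq Sigma) : Prop :=
  match w with
  | [::] => q \in final A
  | a :: w' => exists2 q', trans q a q' & accepts_from q' w'
  end.

Definition language : set (seq Sigma) :=
  [set w | exists2 q, q \in initial A & accepts_from q w].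

End Language.

Inductive player := Eexists | Aforall.

Record game (Sigma : finType) := Game {
  game_scheme :> scheme (word_terminals Sigma);
  game_nfa : nfa Sigma;
  owner : nonterms game_scheme -> player
}.

Section Plays.
Variables (Sigma : finType) (G : game Sigma).
Local Notation position := (term (vars G) (nonterms G) (word_terminals Sigma) ground).

(* oi_step F i t t': t is a1 (... (ak (F t1 ... tm))) and t' results from t by
   rewriting this outermost redex with the i-th rule of F. *)
Inductive oi_step : forall F : nonterms G, 'I_(nrules F) -> position -> position -> Prop :=
| oi_redex F (i : 'I_(nrules F)) (ts : args _ _ _ (knd F)) :
    oi_step i (apps (TNon F) ts) (contract (rule i) ts)
| oi_letter a F (i : 'I_(nrules F)) t t' :
    oi_step i t t' -> oi_step i (letter a t) (letter a t').

(* A play with infinitely many moves if nmoves is None, and with exactly n moves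
   if nmoves is Some n; in the latter case pos j is irrelevant for j > n. *)
Record play := Play { pos : nat -> position; nmoves : option nat }.

Definition has_move (p : play) (j : nat) : bool :=
  if nmoves p is Some n then (j < n)%N else true.

Definition maximal_play (p : play) : Prop :=
  [/\ pos p 0 = start_term G,
      forall j, has_move p j ->
        exists F (i : 'I_(nrules F)), oi_step i (pos p j) (pos p j.+1)
    & if nmoves p is Some n then
        forall F (i : 'I_(nrules F)) t, ~ oi_step i (pos p n) t
      else True].

Definition won_by_exists (p : play) : Prop :=
  if nmoves p is Some n then
    exists2 w, pos p n = word_term _ _ w & language (game_nfa G) w
  else True.

(* The rule to use, given the positions up to the current one (included) and the
   non-terminal of the current redex. *)
Definition strategy := seq position -> forall F : nonterms G, 'I_(nrules F).

Definition redex_head (t : position) (F : nonterms G) : Prop :=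
  exists (i : 'I_(nrules F)) t', oi_step i t t'.

Definition conforms (s : strategy) (p : play) : Prop :=
  forall j F, has_move p j -> redex_head (pos p j) F -> owner F = Eexists ->
    oi_step (s (mkseq (pos p) j.+1) F) (pos p j) (pos p j.+1).

Definition winning_strategy (s : strategy) : Prop :=
  forall p, maximal_play p -> conforms s p -> won_by_exists p.

Definition exists_wins : Prop := exists s : strategy, winning_strategy s.

Definition concrete_interp (a : det_terminals G) : dom (pclass_cppo Sigma) (knd a) :=
  match a as a0 return dom (pclass_cppo Sigma) (@knd (det_terminals G) a0) with
  | inl None => word_class [::]
  | inl (Some a) => prepend_cont a
  | inr F => match owner F with
             | Aforall => nary_op (and_cont Sigma) (nrules F)
             | Eexists => nary_op (or_cont Sigma) (nrules F)
             end
  end.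

Definition concrete_model : model (det_terminals G) := Model concrete_interp.

Definition sol_concrete : pclass Sigma := sol_start (determinize G) concrete_model.

End Plays.

(* Main.v *)
(** If the solution is satisfied by the language L, then, since it is a fixed
    point of [rhs_fun], every position whose value is satisfied by L keeps this
    property under all moves of the universal player and under some move of the
    existential one. Playing such moves wins, because a closed position without
    a redex is a word and its value is satisfied by L only if the word is in L.

    Conversely, if the solution is not satisfied, then neither is some Kleene
    iterate at the start symbol. A logical relation [refutes] between values and
    terms, which says at ground kind that the universal player forces a rejected
    word whenever the value is not satisfied, contains the pair of the top
    element and any term; by induction on n it contains the n-th iterate at F
    paired with F, so the universal player forces a rejected word. *)
Require Import Defs.
From mathcomp Require Import all_boot.
From mathcomp Require Import boolp classical_sets.
From Stdlib Require Import Eqdep_dec.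

Set Implicit Arguments.
Unset Strict Implicit.
Unset Printing Implicit Defensive.

(** * Kleene iterates and casts between equal kinds *)

Lemma is_inf_cast (D : cppo) k k' (e : k = k') (c : nat -> dom D k) d :
  is_inf cle c d ->
  is_inf cle (fun n => ecast k (dom D k) e (c n)) (ecast k (dom D k) e d).
Proof. by case: _ / e. Qed.

Lemma sol_is_inf (T : ksyms) (G : det_scheme T) (M : model T) F :
  is_inf cle (fun i => iter i (@rhs_fun T G M) ctop F) (@sol T G M F).
Proof.
have desc : descending cle (fun i => iter i (@rhs_fun T G M) ctop).
  elim=> [|i IH]; first exact: cle_top.
  exact: meet_continuous_mono (@rhs_fun_continuous _ G M) IH.
exact: ((prod_is_inf _ desc).1 (infP desc) F).
Qed.

(** [op_term] carries a cast along [size_map]; with a generic target length the cast can be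
    eliminated. *)
Lemma eval_nary_cast (V N T : ksyms) (M : model T)
    (v : valuation (ksum V N) (ground_dom M)) op m n (e : m = n)
    (f : term V N T (nary m)) :
  eval v f = nary_op op m ->
  eval v (ecast n (term V N T (nary n)) e f) = nary_op op n.
Proof. by case: _ / e. Qed.

(** * Closed terms and application spines *)

Section Closed.
Variables V N T : ksyms.
Local Notation term := (term V N T).

Definition closed k (t : term k) := free_vars t = [::].

Fixpoint closed_args k : args V N T k -> Prop :=
  match k with
  | ground => fun _ => True
  | arrow k1 k2 => fun ts => closed ts.1 /\ closed_args ts.2
  end.

Lemma closed_app k1 k2 (t : term (arrow k1 k2)) u :
  closed (TApp t u) <-> closed t /\ closed u.
Proof.
rewrite /closed /=; split=> [|[-> ->]//].
by case: (free_vars t) => //=; case: (free_vars u).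
Qed.

Lemma closed_apps k (t : term k) ts :
  closed (apps t ts) <-> closed t /\ closed_args ts.
Proof.
elim: k t ts => [|k1 _ k2 IH] t ts /=; first by split=> [|[]].
by rewrite IH closed_app and_assoc.
Qed.

Lemma closed_subst s k (t : term k) :
  (forall x, x \in free_vars t -> closed (s x)) -> closed (subst s t).
Proof.
elim: k / t => //= [x|k1 k2 t1 IH1 t2 IH2] cs; first by apply: cs; rewrite inE.
apply/closed_app; split; [apply: IH1|apply: IH2] => x tx; apply: cs.
  by rewrite mem_cat tx.
by rewrite mem_cat tx orbT.
Qed.

(** Each binder overwrites an entry of [s], so only the variables of [e] outside [bound_vars b]
    still read [s]. *)
Lemma closed_instantiate k (b : binders V k) (e : term ground) s ts :
  closed_args ts ->
  (forall x, x \in free_vars e -> x \notin bound_vars b -> closed (s x)) ->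
  closed (instantiate b e s ts).
Proof.
elim: b s ts => [|x k' b IH] s ts /=.
  by move=> _ cs; apply: closed_subst => x xe; exact: cs.
move=> [ct cts] cs; apply: IH => // y ye yb.
have [<-|nxy] := eqVneq x y; first by rewrite dfwith_in.
by rewrite dfwith_out //; apply: cs => //; rewrite inE negb_or eq_sym nxy.
Qed.

Lemma kind_eq_dec (k k' : kind) : {k = k'} + {k <> k'}.
Proof. by decide equality. Qed.

Lemma apps_inj k (t t' : term k) ts ts' :
  apps t ts = apps t' ts' -> t = t' /\ ts = ts'.
Proof.
elim: k t t' ts ts' => [|k1 _ k2 IH] t t' /=; first by move=> [] [].
move=> [u ts] [u' ts'] /= /IH [E ->].
(* Inverting [TApp] gives equalities of dependent pairs over kinds, which decidable equality of
   kinds turns into plain ones. *)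
inversion E as [[E1 E2]].
have dec := inj_pair2_eq_dec _ kind_eq_dec.
by split; [exact: dec (dec _ _ _ _ E1)|congr pair; exact: dec E2].
Qed.

End Closed.

(** * Letters, words and heads of positions *)

Section WordPositions.
Variables (Sigma : finType) (V N : ksyms).
Local Notation T := (word_terminals Sigma).
Local Notation term := (term V N T).

Definition prepend_word (w : seq Sigma) (t : term ground) : term ground :=
  foldr (@letter Sigma V N) t w.

Fixpoint spine_head k (t : term k) : option N :=
  match t with
  | TNon F => Some F
  | TApp _ _ t1 _ => spine_head t1
  | _ => None
  end.

Lemma spine_head_apps k (t : term k) ts :
  spine_head (apps t ts) = spine_head t.
Proof. by elim: k t ts => //= k1 _ k2 IH t ts; rewrite IH. Qed.

(** On a position with a redex this computes the head of the redex, on a word [None]; uniqueness of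
    the head and normality of words follow. *)
Fixpoint leftmost k (t : term k) : option N :=
  match t with
  | TNon F => Some F
  | TApp _ _ t1 t2 => if leftmost t1 is Some F then Some F else leftmost t2
  | _ => None
  end.

Lemma leftmost_apps k (t : term k) ts F :
  leftmost t = Some F -> leftmost (apps t ts) = Some F.
Proof. by elim: k t ts => //= k1 _ k2 IH t ts tF; apply: IH; rewrite /= tF. Qed.

Lemma leftmost_prepend w t : leftmost (prepend_word w t) = leftmost t.
Proof. by elim: w. Qed.

Lemma letter_inj a a' (t t' : term ground) :
  letter a t = letter a' t' -> a = a' /\ t = t'.
Proof.
move=> E; split.
  pose fst_letter k (u : term k) := match u with
    | TApp _ _ t1 _ => if t1 is TTer (Some b) then b else a | _ => a end.
  exact: (congr1 (@fst_letter ground) E).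
by have [_ []] := @apps_inj V N T (arrow ground ground) _ _ (t, tt) (t', tt) E.
Qed.

End WordPositions.

(** * Values of the determinised rules *)

Section Game.
Variables (Sigma : finType) (G : game Sigma).
Local Notation V := (vars G).
Local Notation N := (nonterms G).
Local Notation T := (word_terminals Sigma).
Local Notation M := (concrete_model G).
Local Notation L := (language (game_nfa G)).
Local Notation term := (term V N T).
Local Notation dom := (dom (ground_dom M)).
Local Notation val := (valuation (ksum V N) (ground_dom M)).

Definition body F (i : 'I_(nrules F)) : term ground :=
  tnth (in_tuple (bodies (s := G) F)) i.

Definition evalT (v : val) k (t : term k) : dom k := eval v (embed (op_syms G) t).

(** The accumulator [x] of the fold is arbitrary, since each step of the induction on [es] absorbs
    one disjunct into it. *)
Lemma satisfied_by_nary_or (v : val) es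
    (f : Defs.term V N (det_terminals G) (nary (size es))) x P t0 :
  eval v f = nary_fold (or_cont Sigma) (size es) x ->
  satisfied_by (eval v (nary_app f)) P <->
  satisfied_by x P \/
  exists i, (i < size es)%N /\ satisfied_by (eval v (nth t0 es i)) P.
Proof.
elim: es f x => [|e es IH] /= f x fE.
  by rewrite fE; split=> [|[//|[i []]]]; [left|].
rewrite (IH _ (or_class x (eval v e))) /= ?fE // satisfied_by_or; split.
- move=> [[xP|eP]|[i [lti iP]]]; [by left|by right; exists 0%N|].
  by right; exists i.+1.
- move=> [xP|[[|i] [lti iP]]]; [by left; left|by left; right|].
  by right; exists i.
Qed.

Lemma satisfied_by_nary_and (v : val) es
    (f : Defs.term V N (det_terminals G) (nary (size es))) x P t0 :
  eval v f = nary_fold (and_cont Sigma) (size es) x ->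
  satisfied_by (eval v (nary_app f)) P <->
  satisfied_by x P /\
  forall i, (i < size es)%N -> satisfied_by (eval v (nth t0 es i)) P.
Proof.
elim: es f x => [|e es IH] /= f x fE.
  by rewrite fE /=; split=> [|[]].
rewrite (IH _ (and_class x (eval v e))) /= ?fE // satisfied_by_and; split.
- by move=> [[xP eP] esP]; split=> // -[|i] //; exact: esP.
- move=> [xP esP]; split; first by split=> //; exact: (esP 0%N).
  by move=> i; exact: (esP i.+1).
Qed.

(** As [bodies F] is non-empty, the junk value of [nary_op] at 0 does not occur: the first body
    starts the fold, and the others are shifted by one index. *)
Lemma satisfied_by_op (v : val) F P :
  satisfied_by (eval v (nary_app (op_term F))) P <->
  match owner F with
  | Aforall => forall i : 'I_(nrules F), satisfied_by (evalT v (body i)) P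
  | Eexists => exists i : 'I_(nrules F), satisfied_by (evalT v (body i)) P
  end.
Proof.
pose t0 : Defs.term V N (det_terminals G) ground :=
  embed (op_syms G) (@TTer V N T None).
have bodyE (i : 'I_(nrules F)) : evalT v (body i) =
    eval v (nth t0 [seq embed (op_syms G) e | e <- bodies F] i).
  rewrite (nth_map (@TTer V N T None : term ground)) ?ltn_ord //.
  by rewrite /evalT /body (tnth_nth (@TTer V N T None : term ground)).
have opE : eval v (op_term F) = match owner F with
    | Aforall => nary_op (and_cont Sigma) _
    | Eexists => nary_op (or_cont Sigma) _ end.
  by case E: (owner F); apply: eval_nary_cast => /=; rewrite E.
have szE : size [seq embed (op_syms G) e | e <- bodies F] = nrules F.
  exact: size_map.
have gt0 : (0 < nrules F)%N := bodies_neq0 F.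
(* The type of [op_term F] depends on the list of embedded bodies, so it is generalised before the
   list is destructed. *)
move: (op_term F) bodyE opE szE.
case: [seq _ | e <- _] => [|e es] f bodyE opE szE; first by rewrite -szE in gt0.
case E: (owner F) opE => opE.
- have appE : eval v (TApp f e) = nary_fold (or_cont Sigma) _ (eval v e).
    by rewrite /= opE.
  apply: iff_trans (satisfied_by_nary_or (es := es) P t0 appE) _; split.
    move=> [eP|[i [lti iP]]]; first by exists (Ordinal gt0); rewrite bodyE.
    have lti1 : (i.+1 < nrules F)%N by rewrite -szE.
    by exists (Ordinal lti1); rewrite bodyE.
  move=> [[[|i] lti]]; rewrite bodyE /= => iP; first by left.
  by right; exists i; split=> //; rewrite -szE in lti.
- have appE : eval v (TApp f e) = nary_fold (and_cont Sigma) _ (eval v e).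
    by rewrite /= opE.
  apply: iff_trans (satisfied_by_nary_and (es := es) P t0 appE) _; split.
    move=> [eP esP] [[|i] lti]; rewrite bodyE //=.
    by apply: esP; rewrite -szE in lti.
  move=> allP; split=> [|i lti].
    by move: (allP (Ordinal gt0)); rewrite bodyE.
  have lti1 : (i.+1 < nrules F)%N by rewrite -szE.
  by move: (allP (Ordinal lti1)); rewrite bodyE.
Qed.

Lemma evalT_subst (v v' : val) s k (t : term k) :
  (forall x, v' (inl x) = evalT v (s x)) ->
  (forall F, v' (inr F) = v (inr F)) ->
  evalT v' t = evalT v (subst s t).
Proof.
move=> vV vN; elim: k / t => //= k1 k2 t1 IH1 t2 IH2.
by rewrite /evalT /= -!/(evalT _ _) IH1 IH2.
Qed.

(** Semantic beta-reduction: each argument updates valuation and substitution in step. One [v']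
    serves every [e], because all bodies of a non-terminal are evaluated under the same binders. *)
Lemma evalT_apps_binders (v v0 : val) k (b : binders V k)
    (f : cont val (dom ground)) s (t : term k) ts :
  (forall x, v (inl x) = evalT v0 (s x)) ->
  (forall F, v (inr F) = v0 (inr F)) ->
  evalT v0 t = eval_binders b f v ->
  exists2 v', evalT v0 (apps t ts) = f v' &
    forall e, evalT v' e = evalT v0 (instantiate b e s ts).
Proof.
elim: b v s t ts => [|x k' b IH] v s t ts vV vN tE.
  by exists v => // e; exact: evalT_subst.
case: ts => u ts.
apply: (IH (dfwith (i := inl x) v (evalT v0 u)) (dfwith s u)) => [y|F|].
- have [<-|nxy] := eqVneq x y; first by rewrite !dfwith_in.
  by rewrite !dfwith_out.
- by rewrite dfwith_out.
- by rewrite /evalT /= -!/(evalT _ _) tE.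
Qed.

(** * Satisfaction of positions at the solution *)

Definition sol_val : val := extend (sol (G := determinize G) M).

Definition satT (P : set (seq Sigma)) (t : term ground) : Prop :=
  satisfied_by (evalT sol_val t) P.

Lemma satT_letter P a t : satT P (letter a t) <-> satT (P \o cons a) t.
Proof. exact: satisfied_by_prepend. Qed.

Lemma satT_word P w : satT P (word_term _ _ w) <-> P w.
Proof.
elim: w P => [|a w IH] P /=; last by rewrite satT_letter IH.
by rewrite /satT satisfied_by_pi; split=> [/(_ _ erefl)//|Pe f ->].
Qed.

(** The fixed-point equation of [sol] unfolds the head [F] to its determinised rule, whose operator
    is then read by [satisfied_by_op]. *)
Lemma satT_redex P F (ts : args V N T (knd F)) :
  satT P (apps (TNon F) ts) <->
  match owner F with
  | Aforall => forall i : 'I_(nrules F), satT P (contract (rule i) ts)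
  | Eexists => exists i : 'I_(nrules F), satT P (contract (rule i) ts)
  end.
Proof.
have [solE _] := sol_greatest (determinize G) M.
have headE : evalT sol_val (TNon F : term (knd F)) =
    eval_binders (params F)
      (Cont (eval_continuous (M := M) (nary_app (op_term F)))) sol_val.
  exact: (congr1 (fun v : valuation N (ground_dom M) => v F) solE).
have [//|//|v' appsE instE] := evalT_apps_binders (s := TVar) ts _ _ headE.
have sE (i : 'I_(nrules F)) :
    satisfied_by (evalT v' (body i)) P <-> satT P (contract (rule i) ts).
  by rewrite instE.
rewrite /satT appsE /= satisfied_by_op.
case: (owner F); split.
- by move=> [i /sE iP]; exists i.
- by move=> [i /sE iP]; exists i.
- by move=> all_i i; exact: (sE i).1 (all_i i).
- by move=> all_i i; exact: (sE i).2 (all_i i).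
Qed.

(** * Rewriting steps and closed normal forms *)

Lemma oi_step_inv F (i : 'I_(nrules F)) (t t' : term ground) :
  oi_step i t t' -> exists w ts,
    t = prepend_word w (apps (TNon F) ts) /\
    t' = prepend_word w (contract (rule i) ts).
Proof.
elim=> {F i t t'} [F i ts|a F i t t' _ [w [ts [-> ->]]]]; first by exists [::], ts.
by exists (a :: w), ts.
Qed.

Lemma oi_step_prepend w (F : N) (i : 'I_(nrules F)) ts :
  @oi_step _ G F i (prepend_word w (apps (TNon F) ts))
    (prepend_word w (contract (rule i) ts)).
Proof. by elim: w => [|a w IH] /=; [exact: oi_redex|exact: oi_letter]. Qed.


Lemma prepend_redex_inj w w' F ts ts' :
  prepend_word w (apps (TNon F) ts) =
    prepend_word w' (apps (TNon F) ts') :> term ground ->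
  w = w' /\ ts = ts'.
Proof.
(* [spine_head] is [None] on a letter and [Some F] on the redex. *)
have redex_neq a (t : term ground) ts1 : letter a t <> apps (TNon F) ts1.
  by move=> /(congr1 (@spine_head _ _ _ ground)); rewrite spine_head_apps.
elim: w w' => [|a w IH] [|a' w'] /=.
- by move=> /apps_inj[].
- by move=> /esym /redex_neq.
- by move=> /redex_neq.
- by move=> /letter_inj[-> /IH[-> ->]].
Qed.

Lemma oi_step_det F (i : 'I_(nrules F)) (t t1 t2 : term ground) :
  oi_step i t t1 -> oi_step i t t2 -> t1 = t2.
Proof.
move=> /oi_step_inv[w [ts [-> ->]]] /oi_step_inv[w' [ts' [E ->]]].
by have [-> ->] := prepend_redex_inj E.
Qed.

Lemma leftmost_oi_step F (i : 'I_(nrules F)) (t t' : term ground) :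
  oi_step i t t' -> leftmost t = Some F.
Proof.
by move=> /oi_step_inv[w [ts [-> _]]]; rewrite leftmost_prepend; exact: leftmost_apps.
Qed.

Lemma redex_head_uniq (t : term ground) F F' :
  redex_head t F -> redex_head t F' -> F = F'.
Proof.
by move=> [i [t1 /leftmost_oi_step tF]] [j [t2 /leftmost_oi_step]];
  rewrite tF => -[].
Qed.

Lemma word_term_normal w F (i : 'I_(nrules F)) t :
  ~ oi_step i (word_term V N w) t.
Proof. by move=> /leftmost_oi_step; elim: w. Qed.

Lemma closed_oi_step F (i : 'I_(nrules F)) (t t' : term ground) :
  oi_step i t t' -> closed t -> closed t'.
Proof.
elim=> {F i t t'} [F i ts /closed_apps[_ cts]|a F i t t' _ IH /closed_app[_ /IH]].
  apply: closed_instantiate => // x xe; rewrite (bodies_closed xe) //.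
by move=> ct'; apply/closed_app.
Qed.

(** A reducibility predicate in the style of Tait: the arrow case makes induction over closed terms
    pass through subterms of higher kind. *)
Fixpoint progresses k : term k -> Prop :=
  match k with
  | ground => fun t => (exists w, t = word_term V N w) \/
      exists w F ts, t = prepend_word w (apps (TNon F) ts)
  | arrow k1 k2 => fun t => forall u, progresses u -> progresses (TApp t u)
  end.

Lemma progresses_redex k (t : term k) :
  (forall ts, exists F ts', apps t ts = apps (TNon F) ts') -> progresses t.
Proof.
elim: k t => [|k1 _ k2 IH] t redex_t /=.
  by right; exists [::]; have [F [ts' /= ->]] := redex_t tt; exists F, ts'.
by move=> u _; apply: IH => ts; exact: (redex_t (u, ts)).
Qed.

Lemma progresses_closed k (t : term k) : closed t -> progresses t.
Proof.
elim: k / t => [//|F _|[a|] _|k1 k2 t1 IH1 t2 IH2 /closed_app[/IH1 p1 /IH2 p2]].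
- by apply: progresses_redex => ts; exists F, ts.
- move=> u [[w ->]|[w [F [ts ->]]]]; first by left; exists (a :: w).
  by right; exists (a :: w), F, ts.
- by left; exists [::].
- exact: p1.
Qed.

(** * From satisfaction to a winning strategy *)

Lemma closed_start_term : closed (start_term G).
Proof. by rewrite /start_term; case: _ / (start_ground G). Qed.

Lemma evalT_cast (v : val) k k' (e : k = k') (t : term k) :
  evalT v (ecast k (term k) e t) = ecast k (dom k) e (evalT v t).
Proof. by case: _ / e. Qed.

Lemma evalT_start_term : evalT sol_val (start_term G) = sol_concrete G.
Proof. exact: evalT_cast. Qed.

(** [P] varies in the induction, since going below a letter [a] replaces it by [P \o cons a]. *)
Lemma satT_oi_step P F (i : 'I_(nrules F)) (t t' : term ground) :
  owner F = Aforall -> oi_step i t t' -> satT P t -> satT P t'.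
Proof.
move=> oF st; elim: st P oF => {F i t t'} [F i ts|a F i t t' _ IH] P oF.
  by rewrite satT_redex oF.
by rewrite !satT_letter; exact: IH.
Qed.

Lemma satT_oi_step_exists P F (i : 'I_(nrules F)) (t t' : term ground) :
  owner F = Eexists -> oi_step i t t' -> satT P t ->
  exists j : 'I_(nrules F), exists2 u, oi_step j t u & satT P u.
Proof.
move=> oF st; elim: st P oF => {F i t t'} [F i ts|a F i t t' _ IH] P oF.
  rewrite satT_redex oF => -[j jP]; exists j, (contract (rule j) ts) => //.
  exact: oi_redex.
rewrite satT_letter => /IH[//|j [u tu uP]]; exists j, (letter a u).
  exact: oi_letter.
exact/satT_letter.
Qed.

Lemma satisfied_exists_wins : satisfied_by (sol_concrete G) L -> exists_wins G.
Proof.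
move=> satS.
pose good (t : term ground) F (j : 'I_(nrules F)) :=
  exists2 u, oi_step j t u & satT L u.
(* Only the last position of the history matters; rule 0 is the default if no rule preserves
   satisfaction. *)
pose s (h : seq (term ground)) F : 'I_(nrules F) :=
  xget (Ordinal (bodies_neq0 F)) [set j | good (last (start_term G) h) F j]%classic.
exists s => -[p n] [p0 steps stop] conf.
(* Closedness is carried along because progress at the final position needs it. *)
have inv j : (forall i, (i < j)%N -> has_move (Play p n) i) ->
    closed (p j) /\ satT L (p j).
  elim: j => [_|j IH hm].
    rewrite (p0 : p 0 = _); split; first exact: closed_start_term.
    by rewrite /satT evalT_start_term.
  have [|cj sj] := IH; first by move=> i ij; apply: hm; exact: ltnW.
  have hj := hm j (ltnSn j).
  have [F [i st]] := steps j hj.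
  split; first exact: closed_oi_step st cj.
  case oF: (owner F); last exact: satT_oi_step oF st sj.
  have ex_good := satT_oi_step_exists oF st sj.
  have := conf j F hj (ex_intro _ i (ex_intro _ _ st)) oF.
  rewrite /s mkseqS last_rcons /= => st'.
  have [u tu uP] := xgetPex (Ordinal (bodies_neq0 F)) ex_good.
  by rewrite (oi_step_det st' tu).
case: n {conf steps p0} stop inv => [n|//] /= stop inv.
have [|/progresses_closed [[w pw]|[w [F [ts pw]]]] sn] := inv n.
- by move=> i.
- by exists w => //; move: sn; rewrite pw satT_word.
- have := oi_step_prepend w (Ordinal (bodies_neq0 F)) ts.
  by rewrite -pw => /stop.
Qed.

(** * Positions where the universal player forces a rejected word *)

Inductive forall_forces : term ground -> Prop :=
| forces_reject w : ~ L w -> forall_forces (word_term V N w)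
| forces_forall F (i : 'I_(nrules F)) t t' :
    owner F = Aforall -> oi_step i t t' -> forall_forces t' -> forall_forces t
| forces_exists F t (next : 'I_(nrules F) -> term ground) :
    owner F = Eexists -> (forall i, oi_step i t (next i)) ->
    (forall i, forall_forces (next i)) -> forall_forces t.

(* Only the moves from the j-th one on are constrained: this lets the induction
   extend a play at its end while the strategy sees the whole history. *)
Lemma forces_losing_play (s : strategy G) t : forall_forces t ->
  forall p j, p j = t -> exists q n,
    [/\ (j <= n)%N, forall i, (i <= j)%N -> q i = p i,
        exists2 w, q n = word_term V N w & ~ L w
      & forall i, (j <= i < n)%N ->
          (exists F (r : 'I_(nrules F)), oi_step r (q i) (q i.+1)) /\
          forall F, redex_head (q i) F -> owner F = Eexists ->
            oi_step (s (mkseq q i.+1) F) (q i) (q i.+1)].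
Proof.
(* Extends the play by one move to [u]; the induction hypothesis fixes values only up to [j.+1]. *)
pose ext (p : nat -> term ground) j u i := if (i <= j)%N then p i else u.
have extE p j u i : (i <= j)%N -> ext p j u i = p i by rewrite /ext => ->.
have extS p j u : ext p j u j.+1 = u by rewrite /ext ltnn.
have mkseqE (p q : nat -> term ground) j :
    (forall i, (i <= j)%N -> q i = p i) -> mkseq q j.+1 = mkseq p j.+1.
  move=> qp; rewrite /mkseq; apply/eq_in_map => i.
  by rewrite mem_iota add0n => /andP[_ ij]; exact: qp.
elim=> {t} [w nLw|F r t t' oF st _ IH|F t next oF st _ IH] p j pj.
- exists p, j; split=> //; first by exists w.
  by move=> i /andP[ji ij]; move: (leq_ltn_trans ji ij); rewrite ltnn.
- have [q [n [jn qp end_q moves]]] := IH (ext p j t') j.+1 (extS _ _ _).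
  have qj i : (i <= j)%N -> q i = p i.
    by move=> ij; rewrite qp ?extE // ltnW.
  have qS : q j.+1 = t' by rewrite qp ?extS.
  exists q, n; split=> //; first exact: ltnW.
  move=> i /andP[]; rewrite leq_eqVlt => /predU1P[<- _|ji iN]; last first.
    by apply: moves; rewrite ji.
  rewrite qj // pj qS; split; first by exists F, r.
  move=> F' hF' oF'.
  have FF' := redex_head_uniq hF' (ex_intro _ r (ex_intro _ _ st)).
  by move: oF'; rewrite FF' oF.
(* The existential move is the answer of [s] to the history so far, which later extensions leave
   unchanged. *)
- set r := s (mkseq p j.+1) F.
  have [q [n [jn qp end_q moves]]] := IH r (ext p j (next r)) j.+1 (extS _ _ _).
  have qj i : (i <= j)%N -> q i = p i.
    by move=> ij; rewrite qp ?extE // ltnW.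
  have qS : q j.+1 = next r by rewrite qp ?extS.
  exists q, n; split=> //; first exact: ltnW.
  move=> i /andP[]; rewrite leq_eqVlt => /predU1P[<- _|ji iN]; last first.
    by apply: moves; rewrite ji.
  rewrite (mkseqE _ _ _ qj) qj // pj qS; split; first by exists F, r.
  move=> F' hF' oF'.
  have FF' := redex_head_uniq hF' (ex_intro _ r (ex_intro _ _ (st r))).
  by rewrite FF'; exact: st.
Qed.

(** Since [forall_forces] is inductive, every strategy admits a finite conforming play that ends in
    a rejected word. *)
Lemma forces_start_not_wins : forall_forces (start_term G) -> ~ exists_wins G.
Proof.
move=> fS [s win].
have [q [n [_ q0 [w qn nLw] moves]]] :=
  forces_losing_play s fS (p := fun=> start_term G) (j := 0) erefl.
have [|j F /= jn|w' /= qn' Lw'] := win (Play q (Some n)).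
- split=> [|j /= jn|F i t /=]; first exact: q0.
    by have [] := moves j jn.
  by rewrite qn; exact: word_term_normal.
- by have [_] := moves j jn; exact.
(* Injectivity of [word_term], read off from [satT_word] at the singleton language of [w]. *)
- suff ww' : w = w' by rewrite ww' in nLw.
  have := satT_word [set w]%classic w'; rewrite -qn' qn satT_word => -[+ _].
  by move=> /(_ erefl) ->.
Qed.

(** * Logical relation between values and terms *)

(* w is the word already produced in front of t. *)
Fixpoint refutes k : dom k -> term k -> Prop :=
  match k return dom k -> term k -> Prop with
  | ground => fun d t => forall w,
      ~ satisfied_by d [set u | L (w ++ u)]%classic ->
      forall_forces (prepend_word w t)
  | arrow k1 k2 => fun f t => forall d u,
      refutes d u -> refutes ((f : cont (dom k1) (dom k2)) d) (TApp t u)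
  end.

Lemma refutes_top k (t : term k) : refutes ctop t.
Proof.
elim: k t => [|k1 _ k2 IH] t /=; last by move=> d u _; exact: IH.
by move=> w []; apply/satisfied_by_pi => f ->.
Qed.

Definition refutes_env (v : val) (s : forall x : V, term (knd x)) :=
  (forall x, refutes (v (inl x)) (s x)) /\
  (forall F : N, refutes (v (inr F)) (TNon F)).

(** The fundamental lemma of the logical relation, by induction on [t]. *)
Lemma refutes_evalT v s k (t : term k) :
  refutes_env v s -> refutes (evalT v t) (subst s t).
Proof.
move=> [vV vN]; elim: k / t => [x|F|[a|]|k1 k2 t1 IH1 t2 IH2].
- exact: vV.
- exact: vN.
- move=> d u du w; rewrite satisfied_by_prepend => nsat.
  (* The letter moves from the term to the end of the word already produced. *)
  have := du (rcons w a); rewrite /prepend_word foldr_rcons; apply.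
  move=> sat; apply: nsat; move: sat; congr satisfied_by.
  by apply/funext => x /=; rewrite cat_rcons.
- move=> w nsat; apply: forces_reject => Lw; apply: nsat.
  by apply/satisfied_by_pi => f -> /=; rewrite cats0.
- exact: IH1.
Qed.

(** The hypothesis treats full application, with [s'] the substitution that [instantiate] reaches;
    each binder adds one related pair to the environment. *)
Lemma refutes_binders k (b : binders V k) (f : cont val (dom ground)) v s t :
  refutes_env v s ->
  (forall ts v' s', refutes_env v' s' ->
    (forall e, instantiate b e s ts = subst s' e) ->
    refutes (k := ground) (f v') (apps t ts)) ->
  refutes (eval_binders b f v) t.
Proof.
elim: b v s t => [|x k' b IH] v s t vs H; first exact: (H tt v s vs).
move=> d u du; apply: (IH (dfwith (i := inl x) v d) (dfwith s u)).
  case: vs => vV vN; split=> [y|F]; last by rewrite dfwith_out.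
  have [<-|nxy] := eqVneq x y; first by rewrite !dfwith_in.
  by rewrite !dfwith_out.
by move=> ts v' s' vs' instE; exact: (H (u, ts) v' s' vs' instE).
Qed.

Lemma refutes_iter n F :
  refutes (iter n (@rhs_fun _ (determinize G) M) ctop F) (TNon F).
Proof.
elim: n F => [|n IH] F; first exact: refutes_top.
apply: (refutes_binders (s := TVar)) => [|ts v' s' vs' instE w].
  (* [extend] sends variables to the top element, which is related to every term. *)
  by split=> [x|F'] /=; [exact: refutes_top|exact: IH].
have bodyR i := refutes_evalT (body (F := F) i) vs'.
rewrite /= satisfied_by_op; case oF: (owner F) => nsat.
- apply: (forces_exists (next := fun i => prepend_word w (contract (rule i) ts)) oF).
    by move=> i; exact: oi_step_prepend.
  move=> i; rewrite /contract instE; apply: bodyR => sat.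
  by apply: nsat; exists i.
- have /existsNP[i nsati] := nsat.
  apply: (forces_forall oF (oi_step_prepend w i ts)).
  by rewrite /contract instE; exact: bodyR.
Qed.

Lemma refutes_cast k k' (e : k = k') d (t : term k) :
  refutes d t -> refutes (ecast k (dom k) e d) (ecast k (term k) e t).
Proof. by case: _ / e. Qed.

Lemma exists_wins_satisfied : exists_wins G -> satisfied_by (sol_concrete G) L.
Proof.
move=> win.
have /is_inf_satisfied_by solI :=
  is_inf_cast (start_ground G) (sol_is_inf (G := determinize G) M (start G)).
(* Satisfaction of an infimum is satisfaction of all its members, so a failure shows at some finite
   iterate. *)
apply: (solI L).2 => n; apply: contrapT => nsat.
apply: forces_start_not_wins win.
exact: (refutes_cast (start_ground G) (refutes_iter n (start G))) [::] nsat.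
Qed.

End Game.

Theorem theorem4p4 (Sigma : finType) (G : game Sigma) :
  satisfied_by (sol_concrete G) (language (game_nfa G)) <-> exists_wins G.
Proof.
by split; [exact: satisfied_exists_wins|exact: exists_wins_satisfied].
Qed.
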